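(* Let $X$ be a compact metric space and let $f:X\to X$ be a homeomorphism. (1) If $f$ is pointwise recurrent (i.e. every point of $X$ is recurrent) and expansive, then $(X,f)$ is topologically conjugate to a subsystem of some symbolic system. (2) If $f$ is pointwise positively recurrent (i.e. every point of $X$ is positively recurrent) and expansive, then $(X,f)$ is topologically conjugate to a semisimple subsystem of some symbolic system.
   Context: Let $f$ be a homeomorphism of a compact metric space $(X,d)$. Limit sets: $\omega(x,f)=\{y\in X: \exists\, 0<n_1<n_2<\cdots \text{ such that } f^{n_i}(x)\to y\}$ and $\alpha(x,f)=\{y\in X: \exists\, 0<n_1<n_2<\cdots \text{ such that } f^{-n_i}(x)\to y\}$. Recurrence: a point $x$ is positively recurrent if $x\in\omega(x,f)$, negatively recurrent if $x\in\alpha(x,f)$, and recurrent if it is either positively recurrent or negatively recurrent. Expansivity: $f$ is expansive if there is $c>0$ such that $\sup_{n\in\mathbb{Z}} d(f^n(x),f^n(y))>c$ for all distinct $x,y\in X$. A subset $E\subseteq X$ is invariant if $f(E)=E$; if $E$ is closed and invariant, $(E,f|_E)$ is a subsystem of $(X,f)$. A minimal set is a (nonempty) closed invariant set containing no proper (nonempty) closed invariant subset. The system $(X,f)$ is semisimple if $X$ is the disjoint union of minimal sets; equivalently, for every $x\in X$ the orbit closure $\overline{\{f^n(x):n\in\mathbb{Z}\}}$ is minimal. A symbolic system is a two-sided full shift $(S^{\mathbb{Z}},T)$, where $S$ is a finite discrete set, $S^{\mathbb{Z}}$ has the product topology, and $T$ is the left shift, $(Tx)(n)=x(n+1)$. Two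 systems $(X,f)$ and $(Y,g)$ are topologically conjugate if there is a homeomorphism $h:X\to Y$ with $h\circ f=g\circ h$. *)

(* Defs.v *)
From mathcomp Require Import all_boot all_order all_algebra.
From mathcomp Require Import all_classical all_reals all_analysis.

Set Implicit Arguments.
Unset Strict Implicit.
Unset Printing Implicit Defensive.

Import Order.TTheory GRing.Theory Num.Theory.
Local Open Scope classical_set_scope.
Local Open Scope ring_scope.

(* The inverse is carried as data so that negative iterates can be computed;
   it is determined by the underlying function. *)
Record homeo (X Y : topologicalType) := Homeo {
  homeo_fun :> X -> Y;
  homeo_inv : Y -> X;
  homeoK : cancel homeo_fun homeo_inv;
  homeoVK : cancel homeo_inv homeo_fun;
  homeo_continuous : continuous homeo_fun;
  homeoV_continuous : continuous homeo_inv }.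

Definition iterz (X : topologicalType) (f : homeo X X) (n : int) : X -> X :=
  match n with
  | Posz k => iter k f
  | Negz k => iter k.+1 (homeo_inv f)
  end.

Section Recurrence.
Variables (X : topologicalType) (f : homeo X X).

Definition omega_limit (x : X) : set X :=
  [set y | exists n : nat -> nat,
    [/\ (0 < n 0)%N, {homo n : i j / (i < j)%N} &
        iterz f (n i)%:Z x @[i --> \oo] --> y]].

Definition alpha_limit (x : X) : set X :=
  [set y | exists n : nat -> nat,
    [/\ (0 < n 0)%N, {homo n : i j / (i < j)%N} &
        iterz f (- (n i)%:Z) x @[i --> \oo] --> y]].

Definition positively_recurrent (x : X) : Prop := omega_limit x x.
Definition negatively_recurrent (x : X) : Prop := alpha_limit x x.
Definition recurrent (x : X) : Prop :=
  positively_recurrent x \/ negatively_recurrent x.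

Definition pointwise_recurrent : Prop := forall x, recurrent x.
Definition pointwise_positively_recurrent : Prop :=
  forall x, positively_recurrent x.

End Recurrence.

Definition expansive (R : realType) (X : metricType R) (f : homeo X X) : Prop :=
  exists2 c : R, 0 < c & forall x y : X, x <> y ->
    (c%:E < ereal_sup [set (mdist (iterz f n x) (iterz f n y))%:E
                      | n in [set: int]])%E.

Section Subsystems.
Variables (X : topologicalType) (f : homeo X X).

Definition invariant_set (E : set X) : Prop := f @` E = E.

Definition minimal_set (M : set X) : Prop :=
  [/\ M !=set0, closed M, invariant_set M &
      forall N : set X, N !=set0 -> closed N -> invariant_set N ->
        N `<=` M -> N = M].

Definition semisimple : Prop :=
  exists P : set (set X),
    [/\ forall M, P M -> minimal_set M,
        trivIset P id &
        \bigcup_(M in P) M = [set: X]].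

Record subsystem := Subsystem {
  subsystem_set :> set X;
  subsystem_closed : closed subsystem_set;
  subsystem_invariant : invariant_set subsystem_set }.

Variable E : subsystem.

Lemma restr_subproof (x : E) : f (val x) \in (E : set X).
Proof.
apply/mem_set; have /seteqP[fE _] := subsystem_invariant E.
by apply: fE; exists (val x) => //; exact/set_mem/valP.
Qed.

Lemma restrV_subproof (x : E) : homeo_inv f (val x) \in (E : set X).
Proof.
apply/mem_set; have /seteqP[_ Ef] := subsystem_invariant E.
by have [y Ey <-] := Ef _ (set_mem (valP x)); rewrite homeoK.
Qed.

Definition restr_fun (x : E) : E := exist _ (f (val x)) (restr_subproof x).
Definition restr_inv (x : E) : E := 
  exist _ (homeo_inv f (val x)) (restrV_subproof x).

Lemma restr_funK : cancel restr_fun restr_inv.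
Proof. by move=> x; apply: val_inj; rewrite /= homeoK. Qed.

Lemma restr_invK : cancel restr_inv restr_fun.
Proof. by move=> x; apply: val_inj; rewrite /= homeoVK. Qed.

Lemma restr_continuous (g : X -> X) (h : E -> E) :
  (forall x, val (h x) = g (val x)) -> continuous g -> continuous h.
Proof.
move=> hg /continuousP cg; apply/continuousP => A [B oB <-].
exists (g @^-1` B); first exact: cg.
by apply/seteqP; split => x; rewrite /= -[set_val _]/(val _) -hg.
Qed.

Definition restr : homeo E E :=
  Homeo restr_funK restr_invK
    (restr_continuous (g := f) (h := restr_fun)
       (fun=> erefl) (@homeo_continuous _ _ f))
    (restr_continuous (g := homeo_inv f) (h := restr_inv)
       (fun=> erefl) (@homeoV_continuous _ _ f)).

End Subsystems.

Definition topologically_conjugate (X Y : topologicalType) (f : homeo X X)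
    (g : homeo Y Y) : Prop :=
  exists h : homeo X Y, forall x, h (f x) = g (h x).

Lemma continuous_into_prod (T : topologicalType) (I : Type)
    (K : I -> topologicalType) (g : T -> prod_topology K) :
  (forall i, continuous (fun x => g x i)) -> continuous g.
Proof.
move=> gc x; apply/cvg_sup => i; move: x.
apply/(@continuousP _ (initial_topology (@^~ i))) => A [B oB <-].
by have /continuousP := gc i; exact.
Qed.

Section FullShift.
Variable S : finType.

Definition full_shift : topologicalType :=
  prod_topology (fun _ : int => discrete_topology S).

Definition left_shift_fun (x : full_shift) : full_shift := fun n => x (n + 1).
Definition left_shift_inv (x : full_shift) : full_shift := fun n => x (n - 1).

Lemma left_shift_funK : cancel left_shift_fun left_shift_inv.
Proof.
by move=> x; apply/funext => n; rewrite /left_shift_inv /left_shift_fun subrK.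
Qed.

Lemma left_shift_invK : cancel left_shift_inv left_shift_fun.
Proof.
by move=> x; apply/funext => n; rewrite /left_shift_inv /left_shift_fun addrK.
Qed.

Lemma translate_continuous (k : int) :
  continuous ((fun x n => x (n + k)) : full_shift -> full_shift).
Proof.
apply: continuous_into_prod => n.
exact: (@proj_continuous int (fun=> discrete_topology S) (n + k)).
Qed.

Definition left_shift : homeo full_shift full_shift :=
  Homeo left_shift_funK left_shift_invK
    (translate_continuous (k := 1)) (translate_continuous (k := -1)).

End FullShift.

(* Main.v *)
Require Import Defs.
From mathcomp Require Import all_boot all_order all_algebra.
From mathcomp Require Import all_classical all_reals all_analysis.
From mathcomp Require Import lra zify.

(** The heart of the matter is that [X] contains no continuum with more than
    one point ([continuum_degenerate]).

    Fix an expansivity constant [c] and call a continuum stable when all its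
    forward iterates have diameter at most [c].  If [X] had a nondegenerate
    continuum, it would have arbitrarily small ones; iterating these until they
    become larger than [c] and passing to a limit gives a nondegenerate
    continuum stable under [f] or under its inverse ([stable_or_unstable]), and
    the hypotheses are symmetric in the two.  By expansivity stable continua
    contract uniformly under [f], hence grow backward: there are a size [d],
    independent of the continuum, and for every [eta] a time from which on the
    preimage of a stable continuum of size [eta] contains a stable continuum of
    size [d] ([stable_growth]).  A continuum of size [d] has a subcontinuum of
    size [d / 4] missing the ball of radius [d / 4] about any prescribed point,
    and this piece recovers size [d] after [N] steps backward.  So backward
    orbits under [g = f^N] can be steered around any ball.

    This is used twice in [nonrecurrent_point].  Take a minimal closed set [L],
    invariant under [g] and its inverse, among those that contain a stable
    continuum of size [d].  Steering around a point of [L] and passing to a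
    limit gives a stable continuum [D] of size [d] in [L] whose forward orbit
    stays away from that point.  All points of [D] are asymptotic, so they have
    the same omega-limit set; it misses a point of [L], and therefore does not
    contain [D], by minimality.  Inside [D] and off this limit set, steering
    around the starting place itself gives a point which neither its forward
    nor its backward [g]-orbit accumulates at.  But recurrence under [f] is
    inherited by [f^N] ([omega_power]): a contradiction.

    Once continua are points, the classes for the relation of being joined by a
    chain of steps smaller than [e] ([reach]) are clopen, finitely many, and
    smaller than [c] for small [e] ([small_classes]).  The itinerary with
    respect to these classes is continuous, injective by expansivity, and
    intertwines [f] with the shift.

    For the second part it is enough that [y] in omega([x]) implies [x] in
    omega([y]) ([omega_sym]), since then the omega-limit sets are minimal and
    partition [X].  Otherwise a clopen set contains omega([y]) but not [x]; the
    orbit of [x] enters it for longer and longer times, and a limit of the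
    points from which it enters lies outside while all its later iterates are
    inside, so that it is not positively recurrent. *)

Set Implicit Arguments.
Unset Strict Implicit.
Unset Printing Implicit Defensive.

Import Order.TTheory GRing.Theory Num.Theory.
Local Open Scope classical_set_scope.
Local Open Scope ring_scope.

(** * Limits along ultrafilters and well-chained continua *)

Section UltraLimits.
Context {R : realType} {X : metricType R}.
Hypothesis X_compact : compact [set: X].

Lemma nbhs_mdist (x : X) (e : R) : 0 < e -> nbhs x [set y | mdist x y < e].
Proof. by move=> e0; apply/metricType_numDomainType.nbhs_mdistP; exists e. Qed.

Lemma mdist_quad (x x' y y' : X) :
  mdist x y <= mdist x x' + mdist x' y' + mdist y y'.
Proof.
have := metric_triangle x x' y; have := metric_triangle x' y' y.
by rewrite (metric_sym y' y); lra.
Qed.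

Lemma nbhs_mdist_ex (x : X) (V : set X) :
  nbhs x V -> exists2 e : R, 0 < e & forall y, mdist x y < e -> V y.
Proof. by move=> /metricType_numDomainType.nbhs_mdistP[e /= e0 eV]; exists e. Qed.

Lemma ultra_cvg_ex I (G : set_system I) {UG : UltraFilter G} (u : I -> X) :
  exists p : X, u @ G --> p.
Proof.
have [|p [_ clp]] := X_compact (F := u @ G); first exact: filterT.
exists p => V Vp; have [//|GV] := in_ultra_setVsetC (u @^-1` V) UG.
by have [y [nVy Vy]] := clp (~` V) V GV Vp.
Qed.

(** [(a, b)] adheres to the pairs related by [T i], along [G].  Working with
    pairs carries every metric estimate used below to the limit at once. *)
Definition limit_pair I (G : set_system I) (T : I -> X -> X -> Prop) (a b : X) :=
  forall V W, nbhs a V -> nbhs b W ->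
    \forall i \near G, exists a' b', [/\ V a', W b' & T i a' b'].

Lemma limit_pair_ex I (G : set_system I) {UG : UltraFilter G}
    (T : I -> X -> X -> Prop) :
  (\forall i \near G, exists a b, T i a b) -> exists a b, limit_pair G T a b.
Proof.
move=> GT; have [i0 [a0 [b0 _]]] := filter_ex GT.
have /choice[w wT] : forall i, exists ab : X * X,
    (exists a b, T i a b) -> T i ab.1 ab.2.
  move=> i; have [[a [b Tab]]|nT] := pselect (exists a b, T i a b).
    by exists (a, b).
  by exists (a0, b0).
have [a wa] := ultra_cvg_ex (fst \o w); have [b wb] := ultra_cvg_ex (snd \o w).
exists a, b => V W /wa GV /wb GW; near=> i.
exists (w i).1, (w i).2; split; [ | | apply: wT]; near: i => //.
Unshelve. all: by end_near. Qed.

(** The limit of the sets [S i]: when [G] is an ultrafilter this plays the part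
    of convergence in the Hausdorff metric, and compactness costs nothing. *)
Definition ulim I (G : set_system I) (S : I -> set X) : set X :=
  [set y | forall V, nbhs y V -> \forall i \near G, exists2 a, V a & S i a].

Lemma ulim_pair I (G : set_system I) {FG : Filter G} (S : I -> set X) a b :
  ulim G S a -> ulim G S b -> limit_pair G (fun i a b => S i a /\ S i b) a b.
Proof.
move=> Sa Sb V W /Sa GV /Sb GW; apply: filterS2 GV GW.
by move=> i [a' Va' Sa'] [b' Wb' Sb']; exists a', b'.
Qed.

Lemma limit_pair_diag I (G : set_system I) {FG : Filter G}
    (T : I -> X -> X -> Prop) (S : I -> set X) a b :
  (\forall i \near G, forall a b, T i a b -> S i a /\ S i b) ->
  limit_pair G T a b -> ulim G S a /\ ulim G S b.
Proof.
move=> TS lab; split=> V Vx.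
  apply: filterS2 TS (lab V setT Vx filterT) => i Ti.
  by move=> [a' [b' [Va' _ /Ti[? _]]]]; exists a'.
apply: filterS2 TS (lab setT V filterT Vx) => i Ti.
by move=> [a' [b' [_ Vb' /Ti[_ ?]]]]; exists b'.
Qed.

Lemma ulim_closed I (G : set_system I) {FG : Filter G} (S : I -> set X) :
  closed (ulim G S).
Proof.
move=> y cy V /nbhs_interior Vy; have [z [Sz Vz]] := cy _ Vy.
exact: Sz.
Qed.

Lemma ulim_sub I (G : set_system I) {FG : ProperFilter G} (S : I -> set X) K :
  closed K -> (\forall i \near G, S i `<=` K) -> ulim G S `<=` K.
Proof.
move=> cK SK y Sy; apply: cK => V /Sy GV.
by have [i [Si [a Va Sa]]] := filter_ex (filterI SK GV); exists a; split=> //; exact: Si.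
Qed.

Lemma limit_pair_le I (G : set_system I) {FG : ProperFilter G}
    (T : I -> X -> X -> Prop) (h : X -> X) (c : R) a b :
  continuous h ->
  (\forall i \near G, forall a b, T i a b -> mdist (h a) (h b) <= c) ->
  limit_pair G T a b -> mdist (h a) (h b) <= c.
Proof.
move=> ch Tc lab; rewrite leNgt; apply/negP => clt.
pose e := (mdist (h a) (h b) - c) / 2.
have e0 : 0 < e by rewrite /e; lra.
have Va := ch a _ (nbhs_mdist (h a) e0); have Wb := ch b _ (nbhs_mdist (h b) e0).
have [i [Ti [a' [b' [/= Va' Wb' /Ti Tab]]]]] := filter_ex (filterI Tc (lab _ _ Va Wb)).
have := mdist_quad (h a) (h a') (h b) (h b').
by move: Va' Wb' Tab; rewrite /= /e; lra.
Qed.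

Lemma limit_pair_ge I (G : set_system I) {FG : ProperFilter G}
    (T : I -> X -> X -> Prop) (h : X -> X) (c : R) a b :
  continuous h ->
  (\forall i \near G, forall a b, T i a b -> c <= mdist (h a) (h b)) ->
  limit_pair G T a b -> c <= mdist (h a) (h b).
Proof.
move=> ch Tc lab; rewrite leNgt; apply/negP => clt.
pose e := (c - mdist (h a) (h b)) / 2.
have e0 : 0 < e by rewrite /e; lra.
have Va := ch a _ (nbhs_mdist (h a) e0); have Wb := ch b _ (nbhs_mdist (h b) e0).
have [i [Ti [a' [b' [/= Va' Wb' /Ti Tab]]]]] := filter_ex (filterI Tc (lab _ _ Va Wb)).
have := mdist_quad (h a') (h a) (h b') (h b).
rewrite (metric_sym (h a') (h a)) (metric_sym (h b') (h b)).
by move: Va' Wb' Tab; rewrite /= /e; lra.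
Qed.

Definition chained_set (e : R) (C : set X) :=
  forall P : set X, C `&` P !=set0 -> C `\` P !=set0 ->
    exists a b, [/\ (C `&` P) a, (C `\` P) b & mdist a b < e].

(** For closed subsets of a compact space this is connectedness, and it is the
    form in which connectedness is needed: it passes to limits of finer and
    finer chains, and yields chain classes that are clopen when it fails.  The
    empty set is included. *)
Definition continuum (C : set X) := closed C /\ forall e, 0 < e -> chained_set e C.

(** The points that chains of steps smaller than [e] staying in [Z] lead to
    from [x]. *)
Definition reach (e : R) (Z : set X) (x : X) : set X :=
  [set y | forall Q : set X, Q x ->
    (forall a b, Q a -> Z b -> mdist a b < e -> Q b) -> Q y].

Lemma reachxx e Z x : reach e Z x x. Proof. by []. Qed.

Lemma reach_step e Z x a b : reach e Z x a -> Z b -> mdist a b < e -> reach e Z x b.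
Proof. by move=> xa Zb ab Q Qx Qs; apply: (Qs a) => //; exact: xa. Qed.

Lemma reach1 e Z a b : Z b -> mdist a b < e -> reach e Z a b.
Proof. exact: (reach_step (@reachxx e Z a)). Qed.

Lemma reach_sub e Z x : Z x -> reach e Z x `<=` Z.
Proof. by move=> Zx y; apply. Qed.

Lemma reach_ind e Z x (Q : set X) : Q x ->
  (forall a b, reach e Z x a -> Q a -> reach e Z x b -> mdist a b < e -> Q b) ->
  reach e Z x `<=` Q.
Proof.
move=> Qx Qs y xy; suff [] : (reach e Z x `&` Q) y by [].
apply: xy => [|a b [xa Qa] Zb ab]; first by split=> //; exact: reachxx.
have xb := reach_step xa Zb ab; split=> //; exact: Qs ab.
Qed.

(** A set cutting [reach e Z x] with no step shorter than [e] across the cut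
    would be stable under steps on the side of [x], hence everything. *)
Lemma reach_chained e Z x : chained_set e (reach e Z x).
Proof.
move=> P [a [xa Pa]] [b [xb nPb]]; apply: contrapT => nab.
have no a' b' : (reach e Z x `&` P) a' -> (reach e Z x `\` P) b' -> ~ (mdist a' b' < e).
  by move=> ? ? ?; apply: nab; exists a', b'.
have [Px|nPx] := pselect (P x).
  apply: nPb; move: b xb; apply: reach_ind => // a' b' xa' Pa' xb' ab.
  by apply: contrapT => nPb'; exact: (no a' b').
apply: (_ : (~` P) a) Pa; move: a xa; apply: reach_ind => // a' b' xa' Pa' xb' ab Pb'.
by apply: (no b' a') => //; rewrite metric_sym.
Qed.

(** Suppose that [P] cuts the limit with a gap [e].  The points [e / 3]-close to
    the part of the limit in [P] cut almost every [S i]; since [S i] is chained,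
    a step shorter than [e / 3] crosses that cut, and the limits of its end
    points lie on different sides of [P] at distance less than [e]. *)
Lemma ulim_continuum I (G : set_system I) {UG : UltraFilter G} (S : I -> set X) :
  (forall e, 0 < e -> \forall i \near G, chained_set e (S i)) ->
  continuum (ulim G S).
Proof.
move=> Sch; split; first exact: ulim_closed.
move=> e e0 P [p [Lp Pp]] [q [Lq nPq]]; apply: contrapT => nab.
have no a b : (ulim G S `&` P) a -> (ulim G S `\` P) b -> ~ (mdist a b < e).
  by move=> ? ? ?; apply: nab; exists a, b.
have e3 : 0 < e / 3 by lra.
(* the e / 3-neighborhood of the part of the limit in P *)
pose V := [set y | exists2 l, (ulim G S `&` P) l & mdist l y < e / 3].
pose T i a b := [/\ S i a, V a, S i b, ~ V b & mdist a b < e / 3].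
have GT : \forall i \near G, exists a b, T i a b.
  have Gp := Lp _ (nbhs_mdist p e3); have Gq := Lq _ (nbhs_mdist q e3).
  apply: filterS3 (Sch _ e3) Gp Gq => i chi [p' /= pp' Sp'] [q' /= qq' Sq'].
  have Vp' : V p' by exists p.
  have nVq' : ~ V q'.
    move=> [l Ll lq']; apply: (no l q) => //.
    by have := metric_triangle l q' q; rewrite (metric_sym q'); lra.
  have [||a [b [[Sa Va] [Sb nVb] ab]]] := chi V; [by exists p'|by exists q'|].
  by exists a, b.
have [a [b lab]] := limit_pair_ex GT.
have [La Lb] : ulim G S a /\ ulim G S b.
  by apply: limit_pair_diag lab; apply: nearW => i a' b' [].
have ab : mdist a b <= e / 3.
  apply: (limit_pair_le (h := id)) lab => //; first by move=> ?; exact: cvg_id.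
  by apply: nearW => i a' b' [_ _ _ _ /ltW].
have [Pb|nPb] := pselect (P b).
  have [i [a' [b' [_ /= bb' [_ _ _ nVb' _]]]]] :=
    filter_ex (lab setT _ filterT (nbhs_mdist b e3)).
  by apply: nVb'; exists b.
have [Pa|nPa] := pselect (P a); first by apply: (no a b) => //; lra.
have [i [a' [b' [/= aa' _ [_ [l Ll la'] _ _ _]]]]] :=
  filter_ex (lab _ setT (nbhs_mdist a e3) filterT).
apply: (no l a) => //.
by have := metric_triangle l a' a; rewrite (metric_sym a'); lra.
Qed.

Lemma ultra_seq : exists2 G : set_system nat, UltraFilter G & \oo `<=` G.
Proof.
by have [G [UG sG]] := ultraFilterLemma (_ : ProperFilter \oo); exists G.
Qed.

Lemma limit_pair_eq {G : set_system nat} {UG : UltraFilter G}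
    (T : nat -> X -> X -> Prop) a b :
  \oo `<=` G -> (forall k a b, T k a b -> mdist a b < k.+1%:R^-1) ->
  limit_pair G T a b -> a = b.
Proof.
move=> sG Tk lab; apply: contrapT => /eqP; rewrite -mdist_gt0 => ab0.
suff : mdist a b <= mdist a b / 2 by lra.
apply: (limit_pair_le (h := id)) lab => //; first by move=> ?; exact: cvg_id.
have e2 : 0 < mdist a b / 2 by lra.
apply: filterS (sG _ (near_infty_natSinv_lt (PosNum e2))) => k ke a' b'.
by move=> /Tk/ltW/le_trans; apply; exact: ltW.
Qed.

(** Boundary bumping: a continuum that leaves [Z] contains a subcontinuum from
    [x] to the frontier of [Z], within [Z].  The points reached from [x] inside
    [C `&` Z] by short steps cannot be all of [C], so some short step exits [Z];
    let the step length tend to [0]. *)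
Lemma continuum_bump (C Z : set X) (x : X) :
  continuum C -> closed Z -> C x -> Z x -> ~ (C `<=` Z) ->
  exists C', [/\ continuum C', C' x, C' `<=` C `&` Z &
    exists2 y, C' y & ~ nbhs y Z].
Proof.
move=> [cC chC] cZ Cx Zx nCZ.
have [G UG sG] := ultra_seq.
pose S (k : nat) := reach (k.+1%:R^-1) (C `&` Z) x.
have SCZ k : S k `<=` C `&` Z by exact: reach_sub.
have small e : 0 < e -> \forall k \near G, (k.+1%:R^-1 < e :> R).
  by move=> e0; apply: sG; exact: near_infty_natSinv_lt (PosNum e0).
have exit k : exists a b, [/\ S k a, ~ Z b & mdist a b < k.+1%:R^-1].
  apply: contrapT => nab.
  have k0 : 0 < k.+1%:R^-1 :> R by rewrite invr_gt0 ltr0n.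
  have [||a [b [[Ca Sa] [Cb nSb] ab]]] := chC _ k0 (S k).
  - by exists x; split => //; exact: reachxx.
  - apply: contrapT => nCS; apply: nCZ => y Cy; apply: contrapT => nZy.
    by apply: nCS; exists y; split=> // /SCZ[].
  have [Zb|nZb] := pselect (Z b); last by apply: nab; exists a, b.
  by apply: nSb; exact: reach_step ab.
exists (ulim G S); split.
- apply: ulim_continuum => e e0; apply: filterS (small _ e0) => k ke P PS nPS.
  by have [a [b [? ? ab]]] := reach_chained PS nPS; exists a, b; split=> //;
    exact: lt_trans ke.
- by move=> V /nbhs_singleton Vx; apply: nearW => k; exists x => //; exact: reachxx.
- by apply: ulim_sub; [exact: closedI | exact: nearW].
pose T k a b := [/\ S k a, ~ Z b & mdist a b < k.+1%:R^-1].
have [a [b lab]] : exists a b, limit_pair G T a b by apply: limit_pair_ex; exact: nearW.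
exists a.
  move=> V Va; apply: filterS (lab V setT Va filterT) => k.
  by move=> [a' [b' [Va' _ [Sa' _ _]]]]; exists a'.
have ab : a = b by apply: (limit_pair_eq sG) lab => k a' b' [].
move=> Za; rewrite ab in Za.
by have [k [a' [b' [_ Zb' [_ nZb' _]]]]] := filter_ex (lab setT _ filterT Za).
Qed.

Lemma closed_mdist_le (h : X -> X) (p : X) (r : R) :
  continuous h -> closed [set y | mdist p (h y) <= r].
Proof.
move=> ch y cy /=; rewrite leNgt; apply/negP => lt_r.
have e0 : 0 < mdist p (h y) - r by lra.
have [z [/= pz yz]] := cy _ (ch y _ (nbhs_mdist (h y) e0)).
have := metric_triangle p (h z) (h y); rewrite (metric_sym (h z)).
by move: yz => /=; lra.
Qed.

Lemma closed_mdist_ge (h : X -> X) (p : X) (r : R) :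
  continuous h -> closed [set y | r <= mdist p (h y)].
Proof.
move=> ch y cy /=; rewrite leNgt; apply/negP => lt_r.
have e0 : 0 < r - mdist p (h y) by lra.
have [z [/= pz yz]] := cy _ (ch y _ (nbhs_mdist (h y) e0)).
by have := metric_triangle p (h y) (h z); move: yz => /=; lra.
Qed.

Lemma unif_cont (h : X -> X) (e : R) : continuous h -> 0 < e ->
  exists2 d : R, 0 < d & forall x y, mdist x y < d -> mdist (h x) (h y) < e.
Proof.
move=> ch e0; apply: contrapT => nd.
have [G UG sG] := ultra_seq.
pose T (k : nat) a b := mdist a b < k.+1%:R^-1 /\ e <= mdist (h a) (h b).
have ex k : exists a b, T k a b.
  apply: contrapT => nT; apply: nd.
  exists (k.+1%:R^-1); first by rewrite invr_gt0 ltr0n.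
  by move=> x y xy; rewrite ltNge; apply/negP => le_e; apply: nT; exists x, y.
have [a [b lab]] : exists a b, limit_pair G T a b by apply: limit_pair_ex; exact: nearW.
have ab : a = b by apply: (limit_pair_eq sG) lab => k a' b' [].
have : e <= mdist (h a) (h b).
  by apply: (limit_pair_ge ch _ lab); apply: nearW => k a' b' [].
by rewrite ab mdistxx; lra.
Qed.

Lemma continuum_image (h : X -> X) C : continuous h -> continuum C -> continuum (h @` C).
Proof.
move=> ch [cC chC]; split.
  apply: compact_closed; first exact: metric_hausdorff.
  apply: continuous_compact; first exact: continuous_subspaceT.
  exact: (subclosed_compact cC X_compact).
move=> e /(unif_cont ch)[d d0 hd] P [_ [[p Cp <-] Pp]] [_ [[q Cq <-] nPq]].
have [||a [b [[Ca Pa] [Cb nPb] ab]]] := chC _ d0 (h @^-1` P).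
- by exists p.
- by exists q.
exists (h a), (h b); split; last exact: hd.
- by split=> //; exists a.
- by split=> //; exists b.
Qed.

End UltraLimits.

Definition homeo_sym (X Y : topologicalType) (h : homeo X Y) : homeo Y X :=
  Homeo (homeoVK h) (homeoK h) (@homeoV_continuous _ _ h) (@homeo_continuous _ _ h).

(** * Stable continua of an expansive homeomorphism *)

Section Iterates.
Variable X : topologicalType.

Lemma iter_continuous (h : X -> X) n : continuous h -> continuous (iter n h).
Proof.
move=> ch; elim: n => [|n IH] x; first exact: cvg_id.
exact: (continuous_comp (IH x) (ch _)).
Qed.

Lemma iter_cancel n (h h' : X -> X) : cancel h h' -> cancel (iter n h) (iter n h').
Proof. by move=> hK; elim: n => // n IH x; rewrite iterSr /= hK IH. Qed.

Lemma iter_cancel_le (h h' : X -> X) m n x :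
  cancel h h' -> (m <= n)%N -> iter m h' (iter n h x) = iter (n - m) h x.
Proof. by move=> hK mn; rewrite -{1}(subnKC mn) iterD (iter_cancel _ hK). Qed.

Lemma iter_cancel_ge (h h' : X -> X) m n x :
  cancel h h' -> (n <= m)%N -> iter m h' (iter n h x) = iter (m - n) h' x.
Proof. by move=> hK mn; rewrite -{1}(subnK mn) iterD (iter_cancel _ hK). Qed.

End Iterates.

Section StableContinua.
Context {R : realType} {X : metricType R}.
Hypothesis X_compact : compact [set: X].

Definition expansive_at (c : R) (f : homeo X X) :=
  forall x y, (forall n, mdist (iter n f x) (iter n f y) <= c /\
    mdist (iter n (homeo_inv f) x) (iter n (homeo_inv f) y) <= c) -> x = y.

Lemma expansive_at_inv c f : expansive_at c f -> expansive_at c (homeo_sym f).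
Proof. by move=> ex x y xy; apply: ex => n; have [? ?] := xy n. Qed.

(** Expansivity made uniform by compactness: a limit of counterexamples is a
    pair of distinct points that stay [c]-close forever. *)
Lemma expansive_unif c f eta : expansive_at c f -> 0 < eta ->
  exists N, forall x y, (forall n, (n <= N)%N -> mdist (iter n f x) (iter n f y) <= c /\
    mdist (iter n (homeo_inv f) x) (iter n (homeo_inv f) y) <= c) -> mdist x y < eta.
Proof.
move=> ex eta0; apply: contrapT => nN.
have [G UG sG] := ultra_seq.
pose T N (x y : X) := (forall n, (n <= N)%N -> mdist (iter n f x) (iter n f y) <= c /\
    mdist (iter n (homeo_inv f) x) (iter n (homeo_inv f) y) <= c) /\ eta <= mdist x y.
have exT N : exists x y, T N x y.
  apply: contrapT => nT; apply: nN; exists N => x y xy.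
  rewrite ltNge; apply/negP => le_eta.
  by apply: nT; exists x, y.
have [a [b lab]] : exists a b, limit_pair G T a b.
  by apply: limit_pair_ex => //; exact: nearW.
have ab : a = b.
  apply: ex => n.
  have Gn : \forall k \near G, (n <= k)%N by apply: sG; exact: nbhs_infty_ge.
  have cf := @homeo_continuous _ _ f; have cfi := @homeoV_continuous _ _ f.
  split; [apply: (limit_pair_le _ _ lab); first exact: iter_continuous
         |apply: (limit_pair_le _ _ lab); first exact: iter_continuous];
  by apply: filterS Gn => k nk a' b' [/(_ n nk)[]].
have : eta <= mdist a b.
  apply: (limit_pair_ge (h := id) _ _ lab); first by move=> ?; exact: cvg_id.
  by apply: nearW => k a' b' [].
by rewrite ab mdistxx; lra.
Qed.

Definition stable (c : R) (f : X -> X) (C : set X) :=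
  forall n x y, C x -> C y -> mdist (iter n f x) (iter n f y) <= c.

Definition wide (d : R) (C : set X) := exists x y, [/\ C x, C y & d <= mdist x y].

Lemma stable_sub c f (C D : set X) : C `<=` D -> stable c f D -> stable c f C.
Proof. by move=> CD sD n x y /CD Cx /CD Cy; exact: sD. Qed.

Lemma wide_ulim I (G : set_system I) {UG : UltraFilter G} (S : I -> set X) d :
  (\forall i \near G, wide d (S i)) -> wide d (ulim G S).
Proof.
move=> Sw; pose T i a b := [/\ S i a, S i b & d <= mdist a b].
have [a [b lab]] := limit_pair_ex X_compact (T := T) Sw.
have [La Lb] : ulim G S a /\ ulim G S b.
  by apply: limit_pair_diag lab; apply: nearW => i a' b' [].
exists a, b; split => //.
apply: (limit_pair_ge (h := id) _ _ lab); first by move=> ?; exact: cvg_id.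
by apply: nearW => i a' b' [].
Qed.

Lemma mdist_ulim_le I (G : set_system I) {UG : UltraFilter G} (S : I -> set X)
    (h : X -> X) c : continuous h ->
  (\forall i \near G, forall a b, S i a -> S i b -> mdist (h a) (h b) <= c) ->
  forall a b, ulim G S a -> ulim G S b -> mdist (h a) (h b) <= c.
Proof.
move=> ch Sc a b La Lb; apply: (limit_pair_le ch _ (ulim_pair La Lb)).
by apply: filterS Sc => i Si a' b' []; exact: Si.
Qed.

(** The [n]-th iterates stay close also for the [n] previous times, which is
    most of what [expansive_unif] asks for. *)
Lemma stable_contract c (f : homeo X X) eta : expansive_at c f -> 0 < eta ->
  exists N, forall n x y, (N <= n)%N ->
    (forall m, mdist (iter m f x) (iter m f y) <= c) ->
    mdist (iter n f x) (iter n f y) < eta.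
Proof.
move=> ex /(expansive_unif ex)[N Nxy]; exists N => n x y Nn xy; apply: Nxy => m mN.
have fK := @homeoK _ _ f.
by rewrite -!iterD !(iter_cancel_le _ fK) // (leq_trans mN).
Qed.

Lemma unif_cont_iter (f : X -> X) e N : continuous f -> 0 < e ->
  exists2 d : R, 0 < d & forall n x y, (n <= N)%N -> mdist x y < d ->
    mdist (iter n f x) (iter n f y) < e.
Proof.
move=> cf e0; elim: N => [|N [d1 d10 IH]].
  by exists e => // n x y; rewrite leqn0 => /eqP ->.
have [d2 d20 fd2] := unif_cont X_compact (iter_continuous (n := N.+1) cf) e0.
exists (Num.min d1 d2) => [|n x y]; first by rewrite lt_min d10.
rewrite lt_min leq_eqVlt => /orP[/eqP -> /andP[_ /fd2]//|nN /andP[xy _]].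
exact: IH.
Qed.

(** Large times are covered by [stable_contract], the others by continuity. *)
Lemma stable_small c (f : homeo X X) eta : expansive_at c f -> 0 < eta ->
  exists2 d : R, 0 < d & forall x y, (forall n, mdist (iter n f x) (iter n f y) <= c) ->
    mdist x y < d -> forall n, mdist (iter n f x) (iter n f y) < eta.
Proof.
move=> ex eta0; have [N contr] := stable_contract ex eta0.
have [d d0 fd] := unif_cont_iter N (@homeo_continuous _ _ f) eta0.
exists d => // x y xyc xyd n; have [Nn|/ltnW nN] := leqP N n; first exact: contr.
exact: fd.
Qed.

Lemma filter_forall_le (F : set_system X) {FF : Filter F} N (P : nat -> set X) :
  (forall n, (n <= N)%N -> F (P n)) -> F [set x | forall n, (n <= N)%N -> P n x].
Proof.
elim: N => [|N IH] FP.
  by apply: filterS (FP 0%N (leqnn _)) => x P0 n; rewrite leqn0 => /eqP ->.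
have FN : F [set x | forall n, (n <= N)%N -> P n x].
  by apply: IH => n nN; apply: FP; rewrite (leq_trans nN).
apply: filterS2 FN (FP _ (leqnn N.+1)) => x PN PN1 n.
by rewrite leq_eqVlt => /orP[/eqP ->//|nN]; exact: PN.
Qed.

(** Going back [n] steps, [C] cannot stay stable, as it would have been
    contracted below [eta].  Cut it at the points where some backward iterate
    up to time [n] gets [c / 2]-far from that of [x]: the piece of [C] given by
    boundary bumping is stable at time [-n], and reaches distance [c / 2] from
    [x] at some time in between, so by [stable_small] its size at time [-n]
    cannot be less than a constant [d]. *)
Lemma stable_growth c (f : homeo X X) : 0 < c -> expansive_at c f ->
  exists2 d : R, 0 < d & forall eta, 0 < eta -> exists N, forall n C x y, (N <= n)%N ->
    continuum C -> stable c f C -> C x -> C y -> eta <= mdist x y ->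
    exists D, [/\ continuum D, stable c f D, wide d D & iter n f @` D `<=` C].
Proof.
move=> c0 ex; have c20 : 0 < c / 2 by lra.
have [d d0 dsmall] := stable_small ex c20.
exists d => // eta eta0; have [N contr] := stable_contract ex eta0.
exists N => n C x y Nn cC sC Cx Cy xy.
set fi := homeo_inv f.
have fK : cancel f fi := @homeoK _ _ f; have fiK : cancel fi f := @homeoVK _ _ f.
have cfi : continuous fi := @homeoV_continuous _ _ f.
pose Z := [set z | forall i, (i <= n)%N -> mdist (iter i fi x) (iter i fi z) <= c / 2].
have Zx : Z x by move=> i _; rewrite mdistxx; lra.
have cZ : closed Z.
  move=> z clz i ni.
  apply: (closed_mdist_le (h := iter i fi) (iter_continuous cfi)).
  by apply: closure_subset clz => z' /(_ i ni).
have nCZ : ~ (C `<=` Z).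
  move=> CZ; suff : mdist x y < eta by lra.
  rewrite -(iter_cancel n fiK x) -(iter_cancel n fiK y).
  apply: contr => // m; have [nm|/ltnW mn] := leqP n m.
    by rewrite !(iter_cancel_ge _ fiK nm); exact: sC.
  rewrite !(iter_cancel_le _ fiK mn).
  by have := CZ y Cy (n - m)%N (leq_subr _ _); lra.
have [C' [cC' C'x C'Z [y' C'y' ny']]] := continuum_bump X_compact cC cZ Cx Zx nCZ.
have sD : stable c f (iter n fi @` C').
  move=> m _ _ [a C'a <-] [b C'b <-]; have [nm|/ltnW mn] := leqP n m.
    by rewrite !(iter_cancel_ge _ fiK nm); apply: sC;
      [case: (C'Z a C'a)|case: (C'Z b C'b)].
  rewrite !(iter_cancel_le _ fiK mn).
  have [_ /(_ (n - m)%N (leq_subr _ _)) Za] := C'Z a C'a.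
  have [_ /(_ (n - m)%N (leq_subr _ _)) Zb] := C'Z b C'b.
  have := metric_triangle (iter (n - m) fi a) (iter (n - m) fi x) (iter (n - m) fi b).
  by rewrite (metric_sym (iter (n - m) fi a) (iter (n - m) fi x)); lra.
exists (iter n fi @` C'); split => //.
- by apply: continuum_image => //; exact: iter_continuous.
- exists (iter n fi x), (iter n fi y'); split; [by exists x|by exists y'|].
  rewrite leNgt; apply/negP => xyd; apply: ny'.
  have near_i i : (i <= n)%N -> mdist (iter i fi x) (iter i fi y') < c / 2.
    move=> ni; have := dsmall _ _ _ xyd (n - i)%N.
    rewrite !(iter_cancel_le _ fiK (leq_subr i n)) (subKn ni); apply => m.
    by apply: sD; [exists x|exists y'].
  apply: (filter_forall_le
    (P := fun i => [set z | mdist (iter i fi x) (iter i fi z) <= c / 2])).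
  move=> i /near_i ltc.
  have e0 : 0 < c / 2 - mdist (iter i fi x) (iter i fi y') by lra.
  have yV : \forall z \near y', mdist (iter i fi y') (iter i fi z) <
      c / 2 - mdist (iter i fi x) (iter i fi y').
    exact: (iter_continuous (n := i) cfi (nbhs_mdist (iter i fi y') e0)).
  apply: filterS yV => z /= yz.
  by have := metric_triangle (iter i fi x) (iter i fi y') (iter i fi z); lra.
- move=> _ [_ [a C'a <-] <-]; rewrite (iter_cancel n fiK).
  by case: (C'Z a C'a).
Qed.

Lemma continuum_shrink (C : set X) x s : continuum C -> C x -> 0 < s ->
  ~ (C `<=` [set y | mdist x y <= s]) ->
  exists C', [/\ continuum C', C' x, C' `<=` C, forall y, C' y -> mdist x y <= s
    & exists2 y, C' y & s <= mdist x y].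
Proof.
move=> cC Cx s0 nC; pose Z := [set y | mdist x y <= s].
have cZ : closed Z by apply: (closed_mdist_le (h := id)) => ?; exact: cvg_id.
have [|C' [cC' C'x C'Z [y C'y ny]]] := continuum_bump X_compact cC cZ Cx _ nC.
  by rewrite /Z /= mdistxx ltW.
exists C'; split => // [a /C'Z[]//|a /C'Z[]//|].
exists y => //; rewrite leNgt; apply/negP => xys; apply: ny.
have e0 : 0 < s - mdist x y by lra.
apply: filterS (nbhs_mdist y e0) => z /= yz.
by rewrite /Z /=; have := metric_triangle x y z; lra.
Qed.

(** One of two points at distance [d] is [d / 2]-far from [x0]; keep the piece
    of radius [d / 4] around it. *)
Lemma continuum_avoid (C : set X) d x0 : 0 < d -> continuum C -> wide d C ->
  exists C', [/\ continuum C', C' `<=` C, wide (d / 4) C' &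
    forall y, C' y -> d / 4 <= mdist x0 y].
Proof.
move=> d0 cC [a [b [Ca Cb dab]]].
wlog ha : a b Ca Cb dab / d / 2 <= mdist x0 a.
  move=> wl; have [?|?] := leP (d / 2) (mdist x0 a); first exact: (wl a b).
  apply: (wl b a) => //; first by rewrite metric_sym.
  by have := metric_triangle a x0 b; rewrite (metric_sym a x0); lra.
have d4 : 0 < d / 4 by lra.
have [|C' [cC' C'a C'C C'd [y C'y day]]] := continuum_shrink cC Ca d4.
  by move=> /(_ b Cb) /=; lra.
exists C'; split => //; first by exists a, y.
move=> z /C'd az; have := metric_triangle x0 z a; rewrite (metric_sym z a).
by lra.
Qed.

(** Some continuum has small iterates until time [-n], at which it exceeds [c].
    Only the part of the orbit that survives in a limit of the sets at time
    [-n] is recorded. *)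
Definition backward_growth (c : R) (f : homeo X X) (M : nat) := exists (A : set X) n,
  [/\ continuum A, (M <= n)%N,
    forall m x y, (m < n)%N -> A x -> A y ->
      mdist (iter m (homeo_inv f) x) (iter m (homeo_inv f) y) <= c
  & exists x y, [/\ A x, A y &
      c < mdist (iter n (homeo_inv f) x) (iter n (homeo_inv f) y)]].

(** The limit of the sets at time [-n] has size at least [c], and its iterates
    from time [1] on have size at most [c]: its image is stable. *)
Lemma backward_growth_stable c f : 0 < c -> (forall M, backward_growth c f M) ->
  exists D, [/\ continuum D, stable c f D & exists x y, [/\ D x, D y & x <> y]].
Proof.
move=> c0 /choice[A] /choice[n An].
have [G UG sG] := ultra_seq.
have cf := @homeo_continuous _ _ f; have cfi := @homeoV_continuous _ _ f.
have fiK := @homeoVK _ _ f.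
pose S M := iter (n M) (homeo_inv f) @` A M.
have cS M : continuum (S M).
  by apply: continuum_image; [|exact: iter_continuous|case: (An M)].
exists (f @` ulim G S); split.
- apply: continuum_image => //; apply: ulim_continuum => // e e0.
  by apply: nearW => M; case: (cS M) => _; exact.
- move=> m _ _ [a La <-] [b Lb <-]; rewrite -!iterSr.
  apply: (mdist_ulim_le _ _ La Lb); first exact: iter_continuous.
  have Gm : \forall M \near G, (m.+1 <= M)%N by apply: sG; exact: nbhs_infty_ge.
  apply: filterS Gm => M mM _ _ [a' Aa' <-] [b' Ab' <-].
  have [_ Mn Ac _] := An M; have mn := leq_trans mM Mn.
  rewrite !(iter_cancel_le _ fiK mn); apply: Ac => //.
  by rewrite ltn_subrL (leq_ltn_trans _ mn).
have [a [b [La Lb cab]]] : wide c (ulim G S).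
  apply: wide_ulim; apply: nearW => M; have [_ _ _ [x [y [Ax Ay /ltW xy]]]] := An M.
  by exists (iter (n M) (homeo_inv f) x), (iter (n M) (homeo_inv f) y); split => //;
    [exists x|exists y].
exists (f a), (f b); split; [by exists a|by exists b|].
move=> /(can_inj (@homeoK _ _ f)) ab.
by move: cab; rewrite ab mdistxx; lra.
Qed.

(** By expansivity a small nondegenerate continuum exceeds [c] at some time,
    positive or negative; the first such time is large by continuity. *)
Lemma backward_growth_dichotomy (c : R) f (C : set X) x y : 0 < c -> expansive_at c f ->
  continuum C -> C x -> C y -> x <> y ->
  forall M, backward_growth c f M \/ backward_growth c (homeo_sym f) M.
Proof.
move=> c0 ex cC Cx Cy xy M.
have xy0 : 0 < mdist x y by rewrite mdist_gt0; apply/eqP.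
have [d1 d10 fd1] := unif_cont_iter M (@homeo_continuous _ _ f) c0.
have [d2 d20 fd2] := unif_cont_iter M (@homeoV_continuous _ _ f) c0.
pose s := Num.min (mdist x y / 2) (Num.min (d1 / 3) (d2 / 3)).
have s0 : 0 < s by rewrite !lt_min !divr_gt0.
have [sxy sd1 sd2] : [/\ s <= mdist x y / 2, s <= d1 / 3 & s <= d2 / 3].
  by split; rewrite !ge_min lexx ?orbT.
have [|A [cA Ax AC As [y' Ay' xy']]] := continuum_shrink cC Cx s0.
  by move=> /(_ y Cy) /=; lra.
have Ad a b : A a -> A b -> mdist a b < d1 /\ mdist a b < d2.
  by move=> /As xa /As xb; have := metric_triangle a x b; rewrite (metric_sym a x); lra.
pose big n := `[< exists a b, [/\ A a, A b & c < mdist (iter n f a) (iter n f b) \/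
  c < mdist (iter n (homeo_inv f) a) (iter n (homeo_inv f) b)] >].
have exbig : exists n, big n.
  apply: contrapT => nbig; suff : x = y' by move=> e; move: xy'; rewrite -e mdistxx; lra.
  apply: ex => n; rewrite !leNgt; split; apply/negP => lt_c; apply: nbig; exists n;
    by apply/asboolP; exists x, y'; split; auto.
have [n /asboolP[a [b [Aa Ab ab]]] nmin] := ex_minnP exbig.
have small m a' b' : (m < n)%N -> A a' -> A b' ->
    mdist (iter m f a') (iter m f b') <= c /\
    mdist (iter m (homeo_inv f) a') (iter m (homeo_inv f) b') <= c.
  move=> mn Aa' Ab'; rewrite !leNgt; split; apply/negP => lt_c;
    (suff /nmin : big m by rewrite leqNgt mn);
    by apply/asboolP; exists a', b'; split; auto.
have Mn : (M <= n)%N.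
  rewrite leqNgt; apply/negP => /ltnW nM; have [ab1 ab2] := Ad a b Aa Ab.
  by have := fd1 n _ _ nM ab1; have := fd2 n _ _ nM ab2; case: ab; lra.
case: ab => ab; [right|left]; exists A, n; split => //.
- by move=> m a' b' mn Aa' Ab'; have [] := small m a' b' mn Aa' Ab'.
- by exists a, b.
- by move=> m a' b' mn Aa' Ab'; have [] := small m a' b' mn Aa' Ab'.
- by exists a, b.
Qed.

Lemma stable_or_unstable (c : R) f (C : set X) x y : 0 < c -> expansive_at c f ->
  continuum C -> C x -> C y -> x <> y ->
  exists g, (g = f \/ g = homeo_sym f) /\
  exists D, [/\ continuum D, stable c g D & exists x y, [/\ D x, D y & x <> y]].
Proof.
move=> c0 ex cC Cx Cy xy.
have dich := backward_growth_dichotomy c0 ex cC Cx Cy xy.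
have mono h M M' : (M <= M')%N -> backward_growth c h M' -> backward_growth c h M.
  by move=> MM' [A [n [? Mn ? ?]]]; exists A, n; split => //; exact: leq_trans Mn.
have [Pf|] := pselect (forall M, backward_growth c f M).
  by exists f; split; [left|exact: backward_growth_stable].
move=> /existsNP[M0 nM0]; exists (homeo_sym f); split; first by right.
apply: backward_growth_stable => // M; apply: (mono _ _ _ (leq_maxl M M0)).
have [PM|//] := dich (maxn M M0); case: nM0; exact: mono (leq_maxr M M0) PM.
Qed.

End StableContinua.

(** * Omega-limit sets *)

Section Omega.
Context {T : topologicalType}.
Implicit Types (h : T -> T) (x y z : T).

Definition omega h x : set T :=
  [set y | forall V, nbhs y V -> forall n, exists2 k, (n <= k)%N & V (iter k h x)].

Lemma omega_closed h x : closed (omega h x).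
Proof.
move=> y cy V /nbhs_interior/cy[z [xz Vz]] n; exact: xz.
Qed.

Lemma omega_sub h x n0 (K : set T) : closed K ->
  (forall n, (n0 <= n)%N -> K (iter n h x)) -> omega h x `<=` K.
Proof.
move=> cK Kn y xy; apply: cK => V /xy/(_ n0)[k nk Vk].
by exists (iter k h x); split => //; exact: Kn.
Qed.

Lemma omega_image g (p : T -> T) x y : continuous p -> (forall w, p (g w) = g (p w)) ->
  omega g x y -> omega g (p x) (p y).
Proof.
move=> cp pg xy V Vy n; have [k nk Vk] := xy _ (cp y V Vy) n.
exists k => //; have -> // : iter k g (p x) = p (iter k g x).
by elim: k {nk Vk} => //= k ->; rewrite pg.
Qed.

Lemma omega_shift h x n : omega h (iter n h x) `<=` omega h x.
Proof.
move=> y xy V Vy m; have [k mk] := xy V Vy m; rewrite -iterD.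
by exists (k + n)%N => //; rewrite (leq_trans mk) // leq_addr.
Qed.

Lemma omega_step h x y : continuous h -> omega h x y -> omega h x (h y).
Proof.
move=> ch /(omega_image ch (fun=> erefl)); exact: (omega_shift (n := 1)).
Qed.

Lemma omega_back h h' x y : continuous h' -> cancel h h' ->
  omega h x y -> omega h x (h' y).
Proof.
move=> ch' hK xy V Vy n; have [[//|k] nk Vk] := xy _ (ch' y V Vy) n.+1.
by exists k => //; move: Vk; rewrite /= hK.
Qed.

Lemma omega_trans h x y z : continuous h -> omega h x y -> omega h y z -> omega h x z.
Proof.
move=> ch xy yz V /nbhs_interior/yz/(_ 0%N)[k _ Vk] n.
have [l nl Vl] := xy _ (iter_continuous (n := k) ch Vk) n.
exists (k + l)%N; first by rewrite (leq_trans nl) // leq_addl.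
by rewrite iterD.
Qed.

(** With [g = h^N], the set omega([x], [h]) is the union of the sets
    omega([h^i x], [g]) over [i < N].  If [x] is in the [i]-th one, then applying
    [h^i] repeatedly puts [x] in omega([h^(j i) x], [g]) for all [j > 0]; for
    [j = N] the point [h^(N i) x] is on the [g]-orbit of [x]. *)
Lemma omega_power h x N : (0 < N)%N -> continuous h ->
  omega h x x -> omega (iter N h) x x.
Proof.
move=> N0 ch xx; set g := iter N h.
have iter_g q w : iter q g w = iter (q * N) h w by rewrite iterM.
have [i Hi] : exists i, omega g (iter i h x) x.
  apply: contrapT => /forallNP no.
  have /(_ N)[V Vx [n Vn]] : forall M, exists2 V, nbhs x V & exists n,
      forall i k, (i < M)%N -> (n <= k)%N -> ~ V (iter k g (iter i h x)).
    elim=> [|M [V Vx [n Vn]]]; first by exists setT; [exact: filterT|exists 0%N].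
    have /existsNP[W /not_implyP[Wx /existsNP[m Wm]]] := no M.
    exists (V `&` W); first exact: filterI.
    exists (maxn n m) => i k; rewrite ltnS geq_max leq_eqVlt.
    move=> /orP[/eqP -> /andP[_ mk] [_ Wk]|iM /andP[nk _] [Vk _]].
      by apply: Wm; exists k.
    exact: (Vn i k).
  have [k nk] := xx V Vx (n * N)%N; rewrite (divn_eq k N) iterD -iter_g.
  by apply: Vn; [rewrite ltn_mod|rewrite leq_divRL].
have step j : omega g (iter (j.+1 * i) h x) x.
  elim: j => [|j IH]; first by rewrite mul1n.
  apply: omega_trans Hi; first exact: iter_continuous.
  rewrite mulSn iterD; apply: omega_image IH; first exact: iter_continuous.
  by move=> w; rewrite /g -!iterD addnC.
apply: (omega_shift (n := i)); rewrite iter_g mulnC -(prednK N0); exact: step.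
Qed.

End Omega.

(** * A point that is not recurrent *)

(** The properties of stable continua of size at least [d] for [g = f^N] that
    the construction relies on, where [r = d / 4]. *)
Section StableCore.
Context {R : realType} {X : metricType R}.
Hypothesis X_compact : compact [set: X].
Variables (g g' : X -> X) (r : R) (good : set X -> Prop).
Hypothesis gK : cancel g g'.
Hypotheses (cg : continuous g) (cg' : continuous g') (r0 : 0 < r).
Hypothesis good_closed : forall C, good C -> closed C.
Hypothesis good_ex : forall C, good C -> C !=set0.
Hypothesis good_ulim : forall I (G : set_system I) (S : I -> set X),
  UltraFilter G -> (\forall i \near G, good (S i)) -> good (ulim G S).
Hypothesis good_step : forall C x0, good C ->
  exists2 C', good C' & forall y, C' y -> C (g y) /\ r <= mdist x0 (g y).
Hypothesis good_restart : forall C p s, good C -> C p -> 0 < s ->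
  exists m, exists2 C', good C' &
    forall y, C' y -> C (iter m g y) /\ mdist p (iter m g y) <= s.
Hypothesis good_asymptotic : forall C x y e, good C -> C x -> C y -> 0 < e ->
  exists M, forall n, (M <= n)%N -> mdist (iter n g x) (iter n g y) < e.

(** Invariance under both [g] and [g'] is asked for because the sequences of
    continua that steer around a ball are built by going backward, whereas
    their limit is studied through its forward orbit. *)
Let carrier (L : set X) := [/\ closed L, (forall x, L x -> L (g x)),
  (forall x, L x -> L (g' x)) & exists2 C, good C & C `<=` L].

(** The intersection of a chain of carriers contains the limit, along an
    ultrafilter finer than the tails of the chain, of the good sets that they
    contain. *)
Lemma minimal_carrier C : good C -> exists2 L, carrier L &
  forall M, carrier M -> M `<=` L -> L `<=` M.
Proof.
move=> gC; have [|A [cA Amax]] := @Zorn_bigcup X [set B | carrier (~` B)].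
  move=> F FP Ftot; have [F0|/set0P[B0 FB0]] := eqVneq F set0.
    by rewrite F0 bigcup_set0 /= setC0; split => //; exists C.
  have Fc B : F B -> carrier (~` B) by move=> /FP.
  rewrite /= setC_bigcup; split.
  - by apply: closed_bigI => B /Fc[].
  - by move=> x Lx B FB; have [_ + _ _] := Fc B FB; apply; exact: Lx.
  - by move=> x Lx B FB; have [_ _ + _] := Fc B FB; apply; exact: Lx.
  have /choice[D DP] : forall B, exists D, F B -> good D /\ D `<=` ~` B.
    move=> B; have [/Fc[_ _ _ [D gD DB]]|nF] := pselect (F B); first by exists D.
    by exists set0.
  pose base B := [set B' | F B' /\ B `<=` B'].
  have PF : ProperFilter (filter_from F base).
    apply: filter_from_proper; last by move=> B FB; exists B; split.
    apply: filter_from_filter; first by exists B0.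
    move=> B1 B2 F1 F2; have [B12|B21] := Ftot _ _ F1 F2.
      by exists B2 => // B [FB B2B]; split; split => //; exact: subset_trans B2B.
    by exists B1 => // B [FB B1B]; split; split => //; exact: subset_trans B1B.
  have [G [UG sG]] := ultraFilterLemma PF.
  exists (ulim G D).
    apply: good_ulim; apply: sG; exists B0 => // B [FB _].
    by have [] := DP B FB.
  move=> x Lx B FB; apply: (ulim_sub _ _ Lx); first by case: (Fc B FB).
  apply: sG; exists B => // B' [FB' BB']; have [_] := DP B' FB'.
  by move=> /subset_trans; apply; exact: subsetC.
exists (~` A) => // M cM MA; apply: contrapT => nAM.
apply: (Amax (~` M)); last by rewrite /= setCK.
split; first by rewrite -[A]setCK; exact: subsetC.
by move=> MA'; apply: nAM; rewrite -[M]setCK; exact: subsetC.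
Qed.

(** The steering device: [S k] lies [k] steps in the past of [C], and forward
    orbits from [S k] to [C] stay away from [x0]. *)
Lemma avoiding_sequence C x0 : good C -> exists S : nat -> set X,
  [/\ S 0%N = C, forall k, good (S k) &
    forall k j y, S (k + j)%N y -> S k (iter j g y) /\
      ((0 < j)%N -> r <= mdist x0 (iter j g y))].
Proof.
move=> gC; have /choice[next nextP] : forall D, exists D', good D ->
    good D' /\ forall y, D' y -> D (g y) /\ r <= mdist x0 (g y).
  move=> D; have [gD|ngD] := pselect (good D).
    by have [D' gD' DD'] := good_step x0 gD; exists D'.
  by exists D.
have gS k : good (iter k next C).
  by elim: k => //= k /nextP[].
exists (fun k => iter k next C); split => // k; elim=> [|j IH] y; first by rewrite addn0.
rewrite addnS => Sy; have [_ /(_ _ Sy)[Sgy xgy]] := nextP _ (gS (k + j)%N).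
have [Sk xk] := IH _ Sgy; rewrite iterSr; split => // _.
by case: j xk {IH Sy Sgy Sk} => [|j] xk; [|exact: xk].
Qed.

Lemma nonrecurrent_point C : good C -> exists z, ~ omega g z z /\ ~ omega g' z z.
Proof.
move=> gC; have [L [cL Lg Lg' [C0 gC0 C0L]] Lmin] := minimal_carrier gC.
have [G UG sG] := ultra_seq.
have near_ge m : \forall k \near G, (m <= k)%N by apply: sG; exact: nbhs_infty_ge.
have iterL n x : L x -> L (iter n g x) by elim: n => //= n IH /IH/Lg.
have iterL' n x : L x -> L (iter n g' x) by elim: n => //= n IH /IH/Lg'.
have [x0 C0x0] := good_ex gC0.
have [S [S0 gS SP]] := avoiding_sequence x0 gC0.
have SL k : S k `<=` L.
  move=> y Sy; rewrite -(iter_cancel k gK y); apply: iterL'; apply: C0L.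
  by rewrite -S0; have [] := SP 0%N k y Sy.
pose D := ulim G S.
have gD : good D by apply: good_ulim; exact: nearW.
have DL : D `<=` L by apply: ulim_sub => //; exact: nearW.
have Davoid j y : (0 < j)%N -> D y -> r <= mdist x0 (iter j g y).
  move=> j0; apply: (ulim_sub (closed_mdist_ge (iter_continuous (n := j) cg))).
  apply: filterS (near_ge j) => k jk y'.
  by rewrite -{1}(subnK jk) => /SP[_]; exact.
have [y0 Dy0] := good_ex gD.
pose M := omega g y0.
have cM : closed M by exact: omega_closed.
have ML : M `<=` L by apply: (omega_sub (n0 := 0%N)) => // n _; exact/iterL/DL.
(* M is a carrier inside L as soon as it contains D, but it misses x0. *)
have nMx0 : ~ M x0.
  move=> /(_ _ (nbhs_mdist x0 r0) 1%N)[k k0 /=].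
  by rewrite ltNge Davoid.
have [p [Dp nMp]] : exists p, D p /\ ~ M p.
  apply: contrapT => nDM; apply: nMx0; apply: (Lmin M) => //; last exact: C0L.
  split => //; [by move=> x; exact: omega_step|by move=> x; exact: omega_back|].
  exists D => // p Dp; apply: contrapT => nMp; apply: nDM; by exists p.
have [s0 s00 s0M] : exists2 s, 0 < s & forall y, mdist p y < s -> ~ M y.
  by apply: nbhs_mdist_ex; apply: open_nbhs_nbhs; split => //; exact: closed_openC.
(* s < s0 keeps the small continuum off M; s <= r / 2 makes the backward
   orbit, which is r-far from p, stay away from a point s-close to p. *)
pose s := Num.min (s0 / 2) (r / 2).
have [ss0 sr] : s <= s0 / 2 /\ s <= r / 2 by rewrite !ge_min !lexx orbT.
have spos : 0 < s by rewrite lt_min !divr_gt0.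
have [m [C1 gC1 C1P]] := good_restart gD Dp spos.
have [S' [S'0 gS' S'P]] := avoiding_sequence p gC1.
(* These sets decrease to points of D near p whose backward orbit runs
   through the sets S' k. *)
pose W k := iter (m + k) g @` S' k.
have [z [b lz]] : exists z b, limit_pair G (fun k a _ => W k a) z b.
  apply: limit_pair_ex => //; apply: nearW => k; have [c Sc] := good_ex (gS' k).
  by exists (iter (m + k) g c), c, c.
have Wz : ulim G W z.
  move=> V Vz; apply: filterS (lz V setT Vz filterT) => k [a' [b' [Va' _ Wa']]].
  by exists a'.
have [Dz pz] : D z /\ mdist p z <= s.
  have W1 k a : W k a -> D a /\ mdist p a <= s.
    move=> [c Sc <-]; rewrite iterD; apply: C1P.
    by rewrite -S'0; have [] := S'P 0%N k c Sc.
  split; first by apply: (ulim_sub (good_closed gD)) Wz; apply: nearW => k a /W1[].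
  apply: (ulim_sub (closed_mdist_le (h := id) _)) Wz; first by move=> ?; exact: cvg_id.
  by apply: nearW => k a /W1[].
have back j : r <= mdist p (iter (m + j) g' z).
  apply: (ulim_sub (closed_mdist_ge (iter_continuous (n := (m + j)%N) cg'))) Wz.
  apply: filterS (near_ge j.+1) => k jk _ [c Sc <-] /=.
  rewrite (iter_cancel_le _ gK) ?leq_add2l 1?ltnW // subnDl.
  move: Sc; rewrite -{1}(subnKC (ltnW jk)) => /S'P[_]; apply.
  by rewrite subn_gt0.
exists z; split => zz.
  apply: (s0M z); first by lra.
  move=> V /nbhs_mdist_ex[e e0 eV] n.
  have e2 : 0 < e / 2 by lra.
  have [k1 k1P] := good_asymptotic gD Dz Dy0 e2.
  have [k nk zk] := zz _ (nbhs_mdist z e2) (maxn n k1).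
  move: nk; rewrite geq_max => /andP[nk k1k].
  exists k => //; apply: eV; have := k1P k k1k; move: zk => /=.
  by have := metric_triangle z (iter k g z) (iter k g y0); lra.
have r2 : 0 < r / 2 by lra.
have [k mk /=] := zz _ (nbhs_mdist z r2) m.
have := back (k - m)%N; rewrite subnKC //.
by have := metric_triangle p z (iter k g' z); lra.
Qed.

End StableCore.

(** * Continua are points *)

Section Degenerate.
Context {R : realType} {X : metricType R}.
Hypothesis X_compact : compact [set: X].

Lemma stable_continuum_degenerate (c : R) (f : homeo X X) (C : set X) x y :
  0 < c -> expansive_at c f ->
  (forall z, omega f z z \/ omega (homeo_inv f) z z) ->
  continuum C -> stable c f C -> C x -> C y -> x = y.
Proof.
move=> c0 ex rec cC sC Cx Cy; apply: contrapT => /eqP; rewrite -mdist_gt0 => xy0.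
have cf := @homeo_continuous _ _ f; have cfi := @homeoV_continuous _ _ f.
have fK := @homeoK _ _ f; have fiK := @homeoVK _ _ f.
have [d d0 grow] := stable_growth X_compact c0 ex.
have d40 : 0 < d / 4 by lra.
have [N0 growN0] := grow _ d40; pose N := N0.+1.
have growN C1 u v := growN0 N C1 u v (leqnSn N0).
pose g := iter N f; pose g' := iter N (homeo_inv f).
pose good D := [/\ continuum D, stable c f D & wide d D].
have iter_g m z : iter m g z = iter (m * N) f z by rewrite iterM.
suff [z [nz nz']] : exists z, ~ omega g z z /\ ~ omega g' z z.
  by have [/(omega_power (ltn0Sn N0) cf)|/(omega_power (ltn0Sn N0) cfi)] := rec z.
have [M growM] := grow _ xy0.
have [C0 [cC0 sC0 wC0 _]] := growM M C x y (leqnn M) cC sC Cx Cy (lexx _).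
apply: (nonrecurrent_point X_compact (r := d / 4) (good := good)
  _ _ _ _ _ _ _ _ _ _ (C := C0)) => //.
- exact: iter_cancel.
- exact: iter_continuous.
- exact: iter_continuous.
- by move=> D [[]].
- by move=> D [_ _ [a [b [Da _ _]]]]; exists a.
- move=> I G S UG gS; split.
  + by apply: ulim_continuum => // e e0; apply: filterS gS => i [[_ ch] _ _]; exact: ch.
  + move=> n a b; apply: mdist_ulim_le; first exact: iter_continuous.
    by apply: filterS gS => i [_ sS _] a' b'; exact: sS.
  + by apply: wide_ulim => //; apply: filterS gS => i [].
- move=> D x0 [cD sD wD].
  have [A [cA AD [a [b [Aa Ab ab]]] Ax0]] :=
    continuum_avoid X_compact x0 d0 cD wD.
  have [D' [cD' sD' wD' D'A]] := growN A a b cA (stable_sub AD sD) Aa Ab ab.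
  exists D' => // z D'z; have Agz : A (g z) by apply: D'A; exists z.
  by split; [exact: AD|exact: Ax0].
- move=> D p s [cD sD [a [b [Da Db ab]]]] Dp s0.
  pose s' := Num.min s (d / 4).
  have [s's s'd] : s' <= s /\ s' <= d / 4 by rewrite !ge_min !lexx orbT.
  have s'0 : 0 < s' by rewrite lt_min s0.
  have [|A [cA Ap AD As [q Aq pq]]] := continuum_shrink X_compact cD Dp s'0.
    move=> Ds; have /= := Ds a Da; have /= := Ds b Db.
    by have := metric_triangle a p b; rewrite (metric_sym a p); lra.
  have [m growm] := grow _ s'0.
  have [D' [cD' sD' wD' D'A]] :=
    growm (m * N)%N A p q (leq_pmulr _ (ltn0Sn N0)) cA (stable_sub AD sD) Ap Aq pq.
  exists m, D' => // z D'z; rewrite iter_g.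
  have Agz : A (iter (m * N) f z) by apply: D'A; exists z.
  by split; [exact: AD|apply: le_trans s's; exact: As].
- move=> D a b e [_ sD _] Da Db e0; have [m contr] := stable_contract X_compact ex e0.
  exists m => n mn; rewrite !iter_g; apply: contr.
    by rewrite (leq_trans mn) // leq_pmulr.
  by move=> k; exact: sD.
Qed.

Lemma continuum_degenerate (c : R) (f : homeo X X) (C : set X) x y :
  0 < c -> expansive_at c f ->
  (forall z, omega f z z \/ omega (homeo_inv f) z z) ->
  continuum C -> C x -> C y -> x = y.
Proof.
move=> c0 ex rec cC Cx Cy; apply: contrapT => xy.
have [g [gf [D [cD sD [a [b [Da Db ab]]]]]]] :=
  stable_or_unstable X_compact c0 ex cC Cx Cy xy.
apply: ab; apply: (stable_continuum_degenerate (f := g) c0 _ _ cD sD Da Db).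
  by case: gf => ->; [|exact: expansive_at_inv].
by move=> z; case: gf => -> //=; case: (rec z); [right|left].
Qed.

End Degenerate.

(** * Chain classes and the clopen coding *)

Section ZeroDimensional.
Context {R : realType} {X : metricType R}.
Hypothesis X_compact : compact [set: X].

Lemma reach_trans (e : R) (Z : set X) x y z :
  reach e Z x y -> reach e Z y z -> reach e Z x z.
Proof.
by move=> xy yz Q Qx Qs; apply: yz => //; exact: xy.
Qed.

Lemma reachT_sym (e : R) (x y : X) : reach e setT x y -> reach e setT y x.
Proof.
move=> xy; apply: (xy (fun z => reach e setT z x)); first exact: reachxx.
move=> a b ax _ ab; apply: reach_trans ax.
by apply: reach1 => //; rewrite metric_sym.
Qed.

Hypothesis degenerate : forall (C : set X) x y, continuum C -> C x -> C y -> x = y.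

(** If pairs related by [T] are joined by arbitrarily short steps, the limit of
    the chain classes that contain them is a continuum, thus a point, at which
    both members of the pairs accumulate. *)
Lemma reach_limit (T : X -> X -> Prop) :
  (forall e, 0 < e -> exists x y, reach e setT x y /\ T x y) ->
  exists p : X, forall V, nbhs p V -> exists x y, [/\ V x, V y & T x y].
Proof.
move=> eT; have [G UG sG] := ultra_seq.
have /choice[a /choice[b ab]] : forall k : nat, exists x, exists y,
    reach k.+1%:R^-1 setT x y /\ T x y.
  by move=> k; apply: eT; rewrite invr_gt0 ltr0n.
have [u [v lab]] : exists u v : X, limit_pair G (fun k u v => u = a k /\ v = b k) u v.
  by apply: limit_pair_ex => //; apply: nearW => k; exists (a k), (b k).
pose S k := reach k.+1%:R^-1 setT (a k).
have cS : continuum (ulim G S).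
  apply: ulim_continuum => // e e0.
  apply: filterS (sG _ (near_infty_natSinv_lt (PosNum e0))) => k ke P PS nPS.
  have [a' [b' [? ? ab']]] := reach_chained PS nPS; exists a', b'; split => //.
  exact: lt_trans ke.
have [Lu Lv] : ulim G S u /\ ulim G S v.
  apply: limit_pair_diag lab; apply: nearW => k _ _ [-> ->].
  by split; [exact: reachxx|case: (ab k)].
have uv := degenerate cS Lu Lv; rewrite -uv in lab.
exists u => V Vu; have [k [a' [b' [Va Vb [a'E b'E]]]]] := filter_ex (lab V V Vu Vu).
by exists (a k), (b k); rewrite -a'E -b'E; split => //; rewrite a'E b'E; case: (ab k).
Qed.

Lemma small_classes (c : R) : 0 < c -> exists2 e : R, 0 < e &
  forall x y : X, reach e setT x y -> mdist x y < c.
Proof.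
move=> c0; apply: contrapT => ne.
have [e e0|p pT] := @reach_limit (fun x y => c <= mdist x y).
  apply: contrapT => nxy; apply: ne; exists e => // x y xy.
  by rewrite ltNge; apply/negP => le_c; apply: nxy; exists x, y.
have c20 : 0 < c / 2 by lra.
have [x [y [/= px py]]] := pT _ (nbhs_mdist p c20).
by have := metric_triangle x p y; rewrite (metric_sym x p); lra.
Qed.

Lemma class_avoids (K : set X) x : closed K -> ~ K x ->
  exists2 e : R, 0 < e & forall y, reach e setT x y -> ~ K y.
Proof.
move=> cK nKx; apply: contrapT => ne.
have [e e0|p pT] := @reach_limit (fun u v => u = x /\ K v).
  apply: contrapT => nxy; apply: ne; exists e => // y xy Ky.
  by apply: nxy; exists x, y.
have Kp : K p by apply: cK => V /pT[_ [v [_ Vv [_ Kv]]]]; exists v.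
apply: nKx; have px : p = x; last by rewrite -px.
apply: contrapT => /eqP; rewrite -mdist_gt0 => px0.
have [u [v [pu _ [ux _]]]] := pT _ (nbhs_mdist p px0).
by move: pu; rewrite ux /= ltxx.
Qed.

(** A cluster point of the sets missed by finite families of classes would be
    missed by its own class, which is a neighborhood of it. *)
Lemma finite_classes (e : R) : 0 < e ->
  exists s : seq X, forall y, exists2 x, x \in s & reach e setT x y.
Proof.
move=> e0; apply: contrapT => ns.
pose missed (s : seq X) : set X := [set y | forall x, x \in s -> ~ reach e setT x y].
have PF : ProperFilter (filter_from setT missed).
  apply: filter_from_proper => [|s _]; last first.
    apply: contrapT => ms; apply: ns; exists s => y; apply: contrapT => ny.
    by apply: ms; exists y => x xs xy; apply: ny; exists x.
  apply: filter_from_filter; first by exists [::].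
  move=> s1 s2 _ _; exists (s1 ++ s2) => // y my.
  by split=> x xs; apply: my; rewrite mem_cat xs ?orbT.
have [|p [_ clp]] := X_compact PF; first exact: filterT.
have [|y [/= py pyd]] := clp (missed [:: p]) _ _ (nbhs_mdist p e0).
  by exists [:: p].
by apply: (py p); [rewrite mem_head|exact: reach1].
Qed.

Lemma clopen_coding (c : R) : 0 < c -> exists (S : finType) (code : X -> S),
  (exists2 e : R, 0 < e & forall x y : X, mdist x y < e -> code x = code y) /\
  (forall x y, code x = code y -> mdist x y < c).
Proof.
move=> c0; have c20 : 0 < c / 2 by lra.
have [e e0 ec] := small_classes c0.
have [s sP] := finite_classes e0.
pose cls (x : X) := fun y => `[< reach e setT x y >].
pose code x : 'I_(size s).+1 := inord (find (cls x) s).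
have hasc x : has (cls x) s.
  have [y ys yx] := sP x; apply/hasP; exists y => //.
  by apply/asboolP; exact: reachT_sym.
have cls_sym x y : reach e setT x y -> cls x = cls y.
  move=> xy; apply/funext => z; apply/asbool_equiv_eq; split => h.
    by apply: reach_trans h; exact: reachT_sym.
  exact: reach_trans h.
exists 'I_(size s).+1, code; split.
  exists e => // x y xy; rewrite /code (cls_sym x y) //.
  exact: reach1.
move=> x y /(congr1 val); rewrite /= !inordK ?ltnS ?find_size // => xy.
have [z [zx zy]] : exists z, reach e setT x z /\ reach e setT y z.
  have := nth_find x (hasc x); rewrite xy => /asboolP zx.
  by exists (nth x s (find (cls y) s)); split => //;
    apply/asboolP; exact: (nth_find x (hasc y)).
by apply: ec; apply: (reach_trans zx); exact: reachT_sym.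
Qed.

End ZeroDimensional.

(** * Recurrence, conjugacy and minimal sets *)

Section HomeoIterates.
Context {X : topologicalType} (f : homeo X X).

Lemma iterz_continuous n : continuous (iterz f n).
Proof.
case: n => k; apply: iter_continuous; first exact: homeo_continuous.
exact: homeoV_continuous.
Qed.

Lemma iterzS n x : iterz f (n + 1) x = iterz f n (f x).
Proof.
case: n => [k|[|k]].
- by rewrite -PoszD addn1 /= -iterSr.
- by rewrite /= homeoK.
- have -> : Negz k.+1 + 1 = Negz k by lia.
  by rewrite /iterz (iterSr k.+1) homeoK.
Qed.

Lemma iterzN k x : iterz f (- k%:Z) x = iter k (homeo_inv f) x.
Proof. by case: k. Qed.

Lemma strict_homo_ge (n : nat -> nat) : {homo n : i j / (i < j)%N} ->
  forall i, (i <= n i)%N.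
Proof. by move=> nh; elim=> // i IH; apply: leq_ltn_trans IH (nh _ _ _). Qed.

Lemma positively_recurrent_omega x : positively_recurrent f x -> omega f x x.
Proof.
move=> [n [_ nh nx]] V /nx[i0 _ Vi] k; exists (n (maxn i0 k)).
  by apply: leq_trans (strict_homo_ge nh _); exact: leq_maxr.
by apply: (Vi (maxn i0 k)); exact: leq_maxl.
Qed.

Lemma negatively_recurrent_omega x : negatively_recurrent f x -> omega (homeo_inv f) x x.
Proof.
move=> [n [_ nh nx]] V /nx[i0 _ Vi] k; exists (n (maxn i0 k)).
  by apply: leq_trans (strict_homo_ge nh _); exact: leq_maxr.
by rewrite -iterzN; apply: (Vi (maxn i0 k)); exact: leq_maxl.
Qed.

End HomeoIterates.

Section Semisimple.

Lemma image_conjugate (X Y : topologicalType) (f : homeo X X) (g : homeo Y Y)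
    (h : homeo X Y)
    (N : set Y) : (forall x, h (f x) = g (h x)) -> invariant_set g N ->
  invariant_set f (h @^-1` N).
Proof.
move=> hfg gN; apply/seteqP; split => [_ [x Nhx <-]|x Nhx] /=.
  by rewrite hfg -gN; exists (h x).
have [y Ny gy] : (g @` N) (h x) by rewrite gN.
exists (homeo_inv h y).
  by rewrite /= homeoVK.
by apply: (can_inj (@homeoK _ _ h)); rewrite hfg homeoVK.
Qed.

Lemma semisimple_conjugate (X Y : topologicalType) (f : homeo X X) (g : homeo Y Y) :
  topologically_conjugate f g -> semisimple f -> semisimple g.
Proof.
move=> [h hfg] [P [Pmin Ptriv Pcov]].
have hiK := homeoK h; have hVK := homeoVK h.
have hVgf y : homeo_sym h (g y) = f (homeo_sym h y).
  by apply: (can_inj hiK); rewrite hfg !hVK.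
exists [set homeo_inv h @^-1` M | M in P]; split.
- move=> _ [M PM <-]; have [[x Mx] cM fM minM] := Pmin M PM; split.
  + by exists (h x); rewrite /= hiK.
  + by apply: (continuous_closedP _).1 cM; exact: homeoV_continuous.
  + exact: (image_conjugate hVgf).
  move=> N [y Ny] cN gN NM; suff hNM : h @^-1` N = M.
    by rewrite -hNM; apply/seteqP; split=> w /=; rewrite hVK.
  apply: minM; [by exists (homeo_inv h y); rewrite /= hVK| | |].
  + by apply: (continuous_closedP _).1 cN; exact: homeo_continuous.
  + exact: image_conjugate.
  by move=> w /NM /=; rewrite hiK.
- move=> _ _ [M1 P1 <-] [M2 P2 <-] [y [/= M1y M2y]].
  by rewrite (Ptriv M1 M2 P1 P2) //; exists (homeo_inv h y).
apply/seteqP; split=> // y _.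
have [M PM My] : (\bigcup_(M in P) M) (homeo_inv h y) by rewrite Pcov.
by exists (homeo_inv h @^-1` M) => //; exists M.
Qed.

End Semisimple.

Section Minimality.
Context {R : realType} {X : metricType R}.
Hypothesis X_compact : compact [set: X].
Variable f : homeo X X.
Hypothesis class_avoids : forall (K : set X) x, closed K -> ~ K x ->
  exists2 e : R, 0 < e & forall y, reach e setT x y -> ~ K y.
Hypothesis rec : forall x, omega f x x.

(** [A] is the clopen class of [x] that avoids omega([y]).  For every [m] the
    orbit of [x] passes so near [y] that it remains out of [A] during [m] steps;
    [w m] is its last position in [A] before. *)
Lemma omega_sym x y : omega f x y -> omega f y x.
Proof.
move=> xy; apply: contrapT => nyx.
have cf := @homeo_continuous _ _ f.
have [e e0 xK] := class_avoids (@omega_closed _ f y) nyx.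
pose A := reach e setT x.
have Anear a b : mdist a b < e -> A a -> A b.
  by move=> ab Aa; exact: (reach_step Aa).
have yA n : ~ A (iter n f y).
  move=> /xK; apply; elim: n => [|n IH] /=; first exact: rec.
  exact: omega_step.
have /choice[w wP] : forall m : nat, exists w, A w /\
    forall j, (0 < j <= m)%N -> ~ A (iter j f w).
  move=> m; pose V := [set z | forall j, (j <= m)%N -> ~ A (iter j f z)].
  have Vy : nbhs y V.
    apply: (filter_forall_le (P := fun j => [set z | ~ A (iter j f z)])) => j _.
    have near_y : \forall z \near y, mdist (iter j f y) (iter j f z) < e.
      exact: (iter_continuous (n := j) cf (nbhs_mdist (iter j f y) e0)).
    apply: filterS near_y => z /= yz Az; apply: (yA j).
    by apply: (Anear _ _ _ Az); rewrite metric_sym.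
  have [k _ Vk] := xy V Vy 0%N.
  pose last_exit n := (n <= k)%N && `[< A (iter n f x) >].
  have ex_exit : exists n, last_exit n.
    by exists 0%N; apply/andP; split => //; apply/asboolP; exact: reachxx.
  have ub n : last_exit n -> (n <= k)%N by case/andP.
  have [n /andP[nk /asboolP An] nmax] := ex_maxnP ex_exit ub.
  exists (iter n f x); split => // j /andP[j0 jm]; rewrite -iterD => Ajn.
  have [jnk|kjn] := leqP (j + n) k.
    have := nmax (j + n)%N; rewrite /last_exit jnk => /(_ (asboolT Ajn)).
    by rewrite leqNgt -{1}[n]add0n ltn_add2r j0.
  apply: (Vk (j + n - k)%N) => //.
    by rewrite leq_subLR (leq_trans _ (leq_add nk jm)) // addnC.
  by rewrite -iterD subnK // ltnW.
have [G UG sG] := ultra_seq.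
have [z wz] := ultra_cvg_ex X_compact w.
have Az : A z.
  have Gz : \forall i \near G, mdist z (w i) < e by exact: (wz _ (nbhs_mdist z e0)).
  have [i zi] := filter_ex Gz.
  by apply: (Anear (w i)); [rewrite metric_sym|exact: (wP i).1].
have nAz j : (0 < j)%N -> ~ A (iter j f z).
  move=> j0 Ajz.
  have Gj : \forall i \near G, (j <= i)%N by apply: sG; exact: nbhs_infty_ge.
  have [i [/= ji zi]] := filter_ex (filterI Gj
    (wz _ (iter_continuous (n := j) cf (nbhs_mdist (iter j f z) e0)))).
  by have [_ /(_ j)] := wP i; rewrite j0 ji => /(_ isT); apply; exact: (Anear _ _ zi Ajz).
have [k k0 zk] := rec (nbhs_mdist z e0) 1.
by apply: (nAz k k0); exact: (Anear _ _ zk Az).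
Qed.

Lemma semisimple_omega : semisimple f.
Proof.
have cf := @homeo_continuous _ _ f; have cfi := @homeoV_continuous _ _ f.
have omega_sub_omega x y : omega f x y -> omega f y `<=` omega f x.
  by move=> xy z; exact: omega_trans.
have invariant_omega x K : closed K -> invariant_set f K -> K x -> omega f x `<=` K.
  move=> cK fK Kx; apply: (omega_sub (n0 := 0%N)) => // n _.
  by elim: n => //= n IH; rewrite -fK; exists (iter n f x).
exists (range (omega f)); split.
- move=> _ [x _ <-]; split.
  + by exists x; exact: rec.
  + exact: omega_closed.
  + apply/seteqP; split=> [_ [y xy <-]|y xy]; first exact: omega_step.
    exists (homeo_inv f y); last exact: homeoVK.
    by apply: omega_back xy => //; exact: homeoK.
  move=> N [y Ny] cN fN Nx; apply/seteqP; split => //.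
  apply: subset_trans (invariant_omega y N cN fN Ny).
  by apply: omega_sub_omega; apply: omega_sym; exact: Nx.
- move=> _ _ [x _ <-] [y _ <-] [z [xz yz]].
  have eqz u : omega f u z -> omega f u = omega f z.
    move=> uz; apply/seteqP; split; apply: omega_sub_omega => //.
    exact: omega_sym.
  by rewrite (eqz x xz) (eqz y yz).
by apply/seteqP; split=> // x _; exists (omega f x); [exists x|exact: rec].
Qed.

End Minimality.

(** * Itineraries *)

Section Coding.
Context {R : realType} {X : metricType R}.
Hypothesis X_compact : compact [set: X].

Lemma expansive_expansive_at (f : homeo X X) : expansive f ->
  exists2 c : R, 0 < c & expansive_at c f.
Proof.
move=> [c c0 ex]; exists c => // x y xy; apply: contrapT => /ex.
apply/negP; rewrite -leNgt; apply: ge_ereal_sup => _ [[n|n] _ <-]; rewrite lee_fin.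
  by case: (xy n).
by case: (xy n.+1).
Qed.

Lemma recurrent_omega (f : homeo X X) x : recurrent f x ->
  omega f x x \/ omega (homeo_inv f) x x.
Proof.
by move=> [/positively_recurrent_omega|/negatively_recurrent_omega]; [left|right].
Qed.

Variables (f : homeo X X) (S : finType) (code : X -> S).

Definition itinerary (x : X) : full_shift S := fun n => code (iterz f n x).

Lemma itinerary_shift x : itinerary (f x) = left_shift S (itinerary x).
Proof. by apply/funext => n; rewrite /itinerary /= /left_shift_fun -iterzS. Qed.

Lemma itinerary_continuous e : 0 < e ->
  (forall x y, mdist x y < e -> code x = code y) -> continuous itinerary.
Proof.
move=> e0 code_e; apply: continuous_into_prod => n x V /= Vx.
have cfn : \forall y \near x, mdist (iterz f n x) (iterz f n y) < e.
  exact: (iterz_continuous (f := f) (n := n) (nbhs_mdist (iterz f n x) e0)).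
apply: filterS cfn => y /= xy; rewrite /itinerary -(code_e _ _ xy).
exact: (nbhs_singleton Vx).
Qed.

Lemma itinerary_inj c : expansive_at c f ->
  (forall x y, code x = code y -> mdist x y <= c) -> injective itinerary.
Proof.
move=> ex code_c x y xy; apply: ex => n; split; apply: code_c.
  exact: (congr1 (fun s : full_shift S => s n%:Z) xy).
rewrite -!iterzN; exact: (congr1 (fun s : full_shift S => s (- n%:Z)) xy).
Qed.

Lemma range_invariant : invariant_set (left_shift S) (range itinerary).
Proof.
apply/seteqP; split=> [_ [_ [x _ <-] <-]|_ [x _ <-]].
  by exists (f x) => //; rewrite itinerary_shift.
exists (itinerary (homeo_inv f x)); first by exists (homeo_inv f x).
by rewrite -itinerary_shift homeoVK.
Qed.

Lemma full_shift_hausdorff : hausdorff_space (full_shift S).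
Proof.
by apply: (@hausdorff_product _ (fun=> discrete_topology S)) => _;
  exact: discrete_hausdorff.
Qed.

Lemma closed_itinerary_image K : continuous itinerary -> closed K ->
  closed (itinerary @` K).
Proof.
move=> ci cK; apply: compact_closed; first exact: full_shift_hausdorff.
apply: continuous_compact; first exact: continuous_subspaceT.
exact: (subclosed_compact cK X_compact).
Qed.

(** A closed subset of [X] has a compact, hence closed, image, which gives both
    the subshift and the continuity of the inverse. *)
Lemma conjugate_subshift : continuous itinerary -> injective itinerary ->
  exists E : subsystem (left_shift S), topologically_conjugate f (restr E).
Proof.
move=> ci inj_i; have cE : closed (range itinerary) by apply: closed_itinerary_image.
pose E := Subsystem cE range_invariant; exists E.
have memE x : itinerary x \in (E : set _) by apply/mem_set; exists x.
pose h (x : X) : E := exist _ (itinerary x) (memE x).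
have hVex (y : E) : exists x, itinerary x = val y.
  by have [x _ xy] := set_mem (valP y); exists x.
pose hV (y : E) : X := projT1 (cid (hVex y)).
have hVE y : itinerary (hV y) = val y by rewrite /hV; case: cid.
have hK : cancel h hV by move=> x; apply: inj_i; rewrite hVE.
have hVK : cancel hV h by move=> y; apply: val_inj; rewrite /= hVE.
have ch : continuous h.
  apply/continuousP => A [B oB <-]; have /continuousP/(_ B oB) := ci.
  by [].
have chV : continuous hV.
  apply/continuousP => A oA; exists (~` (itinerary @` ~` A)).
    by apply: closed_openC; apply: closed_itinerary_image => //; exact: open_closedC.
  apply/seteqP; split => y /=; rewrite -[set_val _]/(val y).
    by move=> nAy; apply: contrapT => nA; apply: nAy; exists (hV y).
  by move=> Ay [x nAx xy]; apply: nAx; have <- : hV y = x by apply: inj_i; rewrite hVE.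
exists (Homeo hK hVK ch chV) => x; apply: val_inj; exact: itinerary_shift.
Qed.

End Coding.

Theorem theorem1p2 (R : realType) (X : metricType R)
    (X_compact : compact [set: X]%classic) (f : homeo X X) :
  (pointwise_recurrent f -> expansive f ->
     exists (S : finType) (E : subsystem (left_shift S)),
       topologically_conjugate f (restr E))
  /\
  (pointwise_positively_recurrent f -> expansive f ->
     exists (S : finType) (E : subsystem (left_shift S)),
       semisimple (restr E) /\ topologically_conjugate f (restr E)).
Proof.
have conj : pointwise_recurrent f -> expansive f ->
    exists (S : finType) (E : subsystem (left_shift S)),
      topologically_conjugate f (restr E).
  move=> rec /expansive_expansive_at[c c0 ex].
  have deg C x y := continuum_degenerate X_compact (C := C) (x := x) (y := y) c0 ex
    (fun z => recurrent_omega (rec z)).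
  have [S [code [[e e0 code_e] code_c]]] := clopen_coding X_compact deg c0.
  exists S; apply: (conjugate_subshift X_compact (code := code)).
    exact: itinerary_continuous e0 code_e.
  by apply: (itinerary_inj ex) => x y /code_c/ltW.
split => // prec fex; have rec : pointwise_recurrent f by move=> x; left.
have [S [E fE]] := conj rec fex; exists S, E; split => //.
apply: semisimple_conjugate fE _.
have [c c0 ex] := expansive_expansive_at fex.
apply: (semisimple_omega X_compact); last by move=> x; exact: positively_recurrent_omega.
apply: class_avoids => // C x y.
exact: (continuum_degenerate X_compact c0 ex (fun z => recurrent_omega (rec z))).
Qed.
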